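(* For each integer $r\ge 2$ there exists $n_0(r)$ such that for all $n>n_0(r)$ the following holds. Let $c\geq 1$ and $0\le\lambda<3(r-1)$ be the integers determined by $$n=2(r-1)+(c-1)\cdot 3(r-1)+\lambda .$$ Then every graph that is most reliable near zero among graphs with $n$ vertices and $r$ redundant edges has an asymptotically most reliable marked structure with $r$ redundant edges and $\lambda$ long chains; that is, it is obtained from an asymptotically most reliable marked structure $(S,L)$ with $r$ redundant edges and $\lambda$ long chains by replacing each edge of $L$ by a path with $c+1$ edges and each edge of $E(S)\setminus L$ by a path with $c$ edges.
   Context: Graphs are finite undirected multigraphs. The redundancy (number of redundant edges) of a graph with $n$ vertices and $m$ edges is $r=m-(n-1)$. If each edge of $G$ fails independently with probability $p$, $U_G(p)$ denotes the probability that $G$ becomes disconnected. A graph with $n$ vertices and $m$ edges is most reliable near zero if there is $p'>0$ such that it minimizes $U_G(p)$ among all graphs with $n$ vertices and $m$ edges, for all $p\in[0,p']$. A cut set is a set of edges whose removal leaves a disconnected graph. A marked (cubic) structure with $r$ redundant edges and $\lambda$ long chains is a pair $(S,L)$ where $S$ is a cubic graph (multigraphs allowed) with $2(r-1)$ vertices, hence $3(r-1)$ edges, and $L\subseteq E(S)$ is a set of $\lambda$ edges, called the long chains. For $1\le k\le 3(r-1)$ and $0\le j\le k$, $\gamma_{k,j}=\gamma_{k,j}(S,L)$ is the number of pairs $(X,J)$ such that $X$ is a cut set of $S$ with exactly $k$ edges and $J\subseteq X\cap L$ has exactly $j$ elements. A marked structure with $r$ redundant edges and $\lambda$ long chains is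 asymptotically most reliable if its sequence of coefficients $\gamma_{1,0},\gamma_{1,1},\gamma_{2,0},\gamma_{2,1},\gamma_{2,2},\gamma_{3,0},\dots$ (pairs $(k,j)$ taken in lexicographic order) is lexicographically minimal among all cubic marked structures with the same $r$ and $\lambda$. *)

(* Defs.v *)
From HB Require Import structures.
From mathcomp Require Import all_boot all_order all_algebra.
From mathcomp Require Import reals.

Set Implicit Arguments.
Unset Strict Implicit.
Unset Printing Implicit Defensive.

Import Order.TTheory GRing.Theory Num.Theory.

(* Finite multigraphs; parallel edges and loops are allowed. The graphs are
   undirected: the order of the two components of [ends e] is only a
   presentation, and connectivity, degree and isomorphism below ignore it. *)
Record mgraph := MGraph {
  vertex : finType;
  edge : finType;
  ends : edge -> vertex * vertex
}.

Definition joins (G : mgraph) (e : edge G) (x y : vertex G) : bool :=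
  (ends e == (x, y)) || (ends e == (y, x)).

Definition redundancy (G : mgraph) : int :=
  (#|edge G|%:Z - (#|vertex G|%:Z - 1))%R.

(* A loop contributes 2. *)
Definition degree (G : mgraph) (v : vertex G) : nat :=
  \sum_(e : edge G) (((ends e).1 == v) + ((ends e).2 == v)).

Definition cubic (G : mgraph) : Prop := forall v : vertex G, degree v = 3.

Definition adj_without (G : mgraph) (X : {set edge G}) : rel (vertex G) :=
  fun x y => [exists e, (e \notin X) && joins e x y].

Definition cut_set (G : mgraph) (X : {set edge G}) : bool :=
  ~~ [forall x, forall y, connect (adj_without X) x y].

Definition isomorphic (G H : mgraph) : Prop :=
  exists (f : vertex G -> vertex H) (g : edge G -> edge H),
    [/\ bijective f, bijective g &
        forall e x y, joins (g e) (f x) (f y) = joins e x y].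

(* The sum ranges over the possible sets X of failed edges. *)
Definition unreliability (R : realType) (G : mgraph) (p : R) : R :=
  (\sum_(X : {set edge G} | cut_set X)
     \prod_(e : edge G) (if e \in X then p else 1 - p))%R.

Definition most_reliable_near_zero (R : realType) (G : mgraph) : Prop :=
  exists2 p' : R, (0 < p' <= 1)%R &
    forall p : R, (0 <= p <= p')%R ->
    forall H : mgraph, #|vertex H| = #|vertex G| -> #|edge H| = #|edge G| ->
      (unreliability G p <= unreliability H p)%R.

Record marked_structure := MarkedStructure {
  base : mgraph;
  long : {set edge base}
}.

(* The number 3 (r - 1) of edges follows by counting degrees. *)
Definition is_cubic_marked (r lambda : nat) (M : marked_structure) : Prop :=
  [/\ cubic (base M), #|vertex (base M)| = 2 * (r - 1) & #|long M| = lambda].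

Definition gamma (M : marked_structure) (k j : nat) : nat :=
  #|[set XJ : {set edge (base M)} * {set edge (base M)} |
      [&& cut_set XJ.1, #|XJ.1| == k,
          XJ.2 \subset XJ.1 :&: long M & #|XJ.2| == j]]|.

Definition gamma_seq (r : nat) (M : marked_structure) : seqlexi nat :=
  [seq gamma M k j | k <- iota 1 (3 * (r - 1)), j <- iota 0 k.+1].

Definition asymptotically_most_reliable
    (r lambda : nat) (M : marked_structure) : Prop :=
  is_cubic_marked r lambda M /\
  forall M' : marked_structure, is_cubic_marked r lambda M' ->
    (gamma_seq r M <= gamma_seq r M')%O.

(* [subdivide len] replaces each edge e of S by a path with [len e] edges
   (assumed positive). The inner vertices of the path are the pairs (e, i) with
   i < len e - 1; [path_point len e k] is the vertex at distance k from the
   first end along the path, and the edges of the path are the pairs (e, k)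
   with k < len e, the k-th one joining the points k and k + 1. *)
Section Subdivide.
Variables (S : mgraph) (len : edge S -> nat).

Definition subdiv_vertex : finType :=
  (vertex S + {e : edge S & 'I_(len e).-1})%type.

Definition subdiv_edge : finType := {e : edge S & 'I_(len e)}.

Definition path_point (e : edge S) (k : nat) : subdiv_vertex :=
  if k is k'.+1 then
    if (insub k' : option 'I_(len e).-1) is Some i
    then inr (Tagged (fun e => 'I_(len e).-1) i)
    else inl (ends e).2
  else inl (ends e).1.

Definition subdivide : mgraph :=
  @MGraph subdiv_vertex subdiv_edge
    (fun d => (path_point (tag d) (tagged d),
               path_point (tag d) (tagged d).+1)).
End Subdivide.

Definition expand (M : marked_structure) (c : nat) : mgraph :=
  subdivide (fun e : edge (base M) => if e \in long M then c.+1 else c).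

(* Main.v *)
(** A chain of a subdivided graph either survives, loses one edge, or loses at
    least two and then cuts the graph. So if every edge e of S becomes a path
    of length l(e), the number of non-cut sets of k edges is the sum, over the
    non-cut sets Y of S with k elements, of the product of l(e) for e in Y.

    Near p = 0 the unreliability is governed lexicographically by the numbers of
    cut sets of size 0, 1, 2, ... A subdivided 3-edge-connected cubic graph (a
    Moebius ladder) has no cut set of size 0 or 1, so a most reliable G has
    none either, and G is a subdivision of a graph S of minimum degree 3. The
    number of non-cut pairs is at most the second elementary symmetric function
    of the lengths, and comparing with the balanced Moebius ladder forces 3(r-1)
    chains, hence S cubic, and lengths c and c + 1. Then the elementary
    symmetric functions of the lengths are determined by r, c and lambda, and
    the k-edge cut sets meeting every chain at most once number
    sum_j gamma_{k,j} c^(k-j); for c > 4^(3(r-1)) this is a base c expansion, so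
    its minimality is the lexicographic minimality of the gamma's. *)

Require Import Defs.
From HB Require Import structures.
From mathcomp Require Import all_boot all_order all_algebra.
From mathcomp Require Import boolp reals zify ring lra.

Set Implicit Arguments.
Unset Strict Implicit.
Unset Printing Implicit Defensive.

Import Order.TTheory GRing.Theory Num.Theory.

(** * Cut sets *)

Lemma joins_sym (G : mgraph) (e : edge G) x y : joins e x y = joins e y x.
Proof. by rewrite /joins orbC. Qed.

Lemma joins_ends (G : mgraph) (e : edge G) : joins e (ends e).1 (ends e).2.
Proof. by rewrite /joins -surjective_pairing eqxx. Qed.

(** A vertex colouring [A] that is not constant but agrees across every surviving edge certifies
    disconnection. Such colourings, unlike paths, transport directly along isomorphisms and
    subdivisions. *)
Lemma cut_setP (G : mgraph) (X : {set edge G}) :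
  reflect (exists A : vertex G -> bool,
             (exists x y, A x != A y) /\
             (forall e, e \notin X -> A (ends e).1 = A (ends e).2))
          (cut_set X).
Proof.
apply: (iffP idP) => [|[A [[x [y Axy]] AX]]].
  rewrite /cut_set => /forallPn[x /forallPn[y nxy]].
  (* The colour class is the component of [x]. *)
  exists (fun z => connect (adj_without X) x z); split.
    by exists x, y; rewrite connect0 (negPf nxy).
  move=> e eX; apply/idP/idP => h; apply: connect_trans h (connect1 _).
    by apply/existsP; exists e; rewrite eX joins_ends.
  by apply/existsP; exists e; rewrite eX joins_sym joins_ends.
apply/forallPn; exists x; apply/forallPn; exists y; apply: contra Axy => cxy.
rewrite -[A x]/(x \in A) -[A y]/(y \in A); apply/eqP.
apply: closed_connect cxy => u v /existsP[e /andP[/AX eA /orP[]/eqP uv]];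
  by rewrite uv /= in eA; rewrite !unfold_in eA.
Qed.

(** Complements are counted because a non-cut set of a subdivision amounts to a non-cut set of
    chains with one edge chosen in each, which yields a product formula. *)
Definition intact (G : mgraph) (k : nat) : nat :=
  #|[set X : {set edge G} | ~~ cut_set X & #|X| == k]|.

Definition cuts (G : mgraph) (k : nat) : nat :=
  #|[set X : {set edge G} | cut_set X & #|X| == k]|.

Lemma card_sized_sets (T : finType) k :
  #|[set X : {set T} | #|X| == k]| = 'C(#|T|, k).
Proof. by rewrite card_draws. Qed.

Lemma cuts_intact G k : cuts G k + intact G k = 'C(#|edge G|, k).
Proof.
rewrite -card_sized_sets -(cardsID [set X : {set edge G} | cut_set X] [set X | _]).
rewrite /cuts /intact; congr addn; apply: eq_card => X; by rewrite !inE // andbC.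
Qed.

Lemma isomorphic_sym G H : isomorphic G H -> isomorphic H G.
Proof.
move=> [f [g [[f' fK f'K] [g' gK g'K] fg]]]; exists f', g'; split.
- by exists f.
- by exists g.
- by move=> e x y; rewrite -{2}[x]f'K -{2}[y]f'K -{2}[e]g'K fg.
Qed.

Lemma isomorphic_suff G H (f : vertex G -> vertex H) (g : edge G -> edge H) :
    bijective f -> bijective g ->
    (forall e, joins (g e) (f (ends e).1) (f (ends e).2)) ->
  isomorphic G H.
Proof.
move=> bf bg fg; exists f, g; split=> // e x y.
have inj := bij_inj bf.
have := fg e; rewrite /joins; case: (ends e) => a b /=.
case/orP=> /eqP->; rewrite !xpair_eqE !inj_eq //.
by rewrite orbC andbC [X in _ || X]andbC.
Qed.

Lemma isomorphic_cut G H   : isomorphic G H ->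
  exists2 g : edge G -> edge H,
    bijective g & forall X, cut_set X -> cut_set (g @: X).
Proof.
move=> [f [g [[f' fK f'K] bg fg]]]; exists g => // X /cut_setP[A [[x [y Axy]] AX]].
apply/cut_setP; exists (A \o f'); split.
  by exists (f x), (f y); rewrite /= !fK.
have [g' gK g'K] := bg => e; rewrite -[e]g'K (mem_imset _ _ (bij_inj bg)) => /AX.
have := joins_ends (g' e); rewrite -fg /joins => /orP[]/eqP-> /=; rewrite !fK //.
Qed.

Lemma isomorphic_intact G H k : isomorphic G H -> intact G k = intact H k.
Proof.
(* By symmetry of isomorphism, one inequality between cut counts is enough. *)
suff le A B : isomorphic A B -> cuts A k <= cuts B k.
  move=> GH; have [g bg _] := isomorphic_cut GH.
  have := cuts_intact G k; have := cuts_intact H k.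
  rewrite (bij_eq_card bg).
  have := le _ _ GH; have := le _ _ (isomorphic_sym GH); lia.
move=> AB; have [g bg gX] := isomorphic_cut AB.
have ig := imset_inj (bij_inj bg).
rewrite /cuts -(card_imset _ ig) subset_leq_card //.
apply/subsetP=> _ /imsetP[X /[!inE] /andP[/gX cX /eqP<-] ->].
by rewrite cX (card_imset _ (bij_inj bg)) eqxx.
Qed.

(** * Subdivisions *)

Section SubdivideTheory.
Variables (S : mgraph) (len : edge S -> nat).
Hypothesis len_gt0 : forall e, 0 < len e.

Local Notation H := (subdivide len).
Local Notation point := (@path_point S len).

Lemma card_vertex_subdivide :
  #|vertex H| = #|vertex S| + \sum_e (len e).-1.
Proof.
rewrite /= card_sum card_tagged; congr (_ + _).
rewrite sumnE big_map big_enum /=.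
by apply: eq_bigr => e _; rewrite card_ord.
Qed.

Lemma card_edge_subdivide : #|edge H| = \sum_e len e.
Proof.
rewrite /= card_tagged sumnE big_map big_enum /=.
by apply: eq_bigr => e _; rewrite card_ord.
Qed.

Lemma path_point0 e : point e 0 = inl (ends e).1.
Proof. by []. Qed.

Lemma path_point_last e : point e (len e) = inl (ends e).2.
Proof.
suff h k : k = len e -> point e k = inl (ends e).2 by exact: h.
case: k => [|k] kl; first by have := len_gt0 e; rewrite -kl.
by rewrite /path_point insubF // -kl ltnn.
Qed.

Lemma path_pointS e (i : 'I_(len e).-1) :
  point e i.+1 = inr (Tagged (fun e => 'I_(len e).-1) i).
Proof. by rewrite /path_point valK. Qed.

(** At most one failed edge per chain: only such sets can leave the subdivision connected. *)
Definition thin (X : {set edge H}) :=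
  [forall d1 in X, forall d2 in X, (tag d1 == tag d2) ==> (d1 == d2)].

Lemma thinP (X : {set edge H}) : reflect {in X &, injective (@tag _ _)} (thin X).
Proof.
apply: (iffP forall_inP) => [h d1 d2 d1X d2X t12 | h d1 d1X].
  by have /forall_inP/(_ _ d2X)/implyP := h _ d1X; rewrite t12 eqxx => /(_ isT)/eqP.
apply/forall_inP=> d2 d2X; apply/implyP=> /eqP t12; exact/eqP/h.
Qed.

Lemma path_point_cases e k : k <= len e ->
  [\/ k = 0, k = len e | exists2 i : 'I_(len e).-1, k = i.+1 &
      point e k = inr (Tagged (fun e => 'I_(len e).-1) i)].
Proof.
case: k => [|k] kl; first by constructor 1.
case: (ltnP k (len e).-1) => h; last by constructor 2; lia.
by constructor 3; exists (Ordinal h) => //; rewrite -(path_pointS (Ordinal h)).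
Qed.

(** Two failed edges [k < k'] of one chain separate the inner points [k + 1, ..., k'] from
    everything else. *)
Lemma cut_set_not_thin (X : {set edge H}) : ~~ thin X -> cut_set X.
Proof.
case/forall_inPn=> -[e k] dX /forall_inPn[[e' k'] d'X].
rewrite negb_imply /= => /andP[/eqP ee']; case: e' / ee' k' d'X => k' d'X.
rewrite eq_Tagged /= => nkk'.
wlog lkk' : k k' dX d'X nkk' / k < k'.
  move=> wl; have := nkk'; rewrite -val_eqE /= neq_ltn => /orP[]; first exact: wl.
  by apply: wl => //; rewrite eq_sym.
(* The inner vertex with index [i] lies at distance [i + 1] from the first end, hence the
   successor. *)
pose A (u : vertex H) := match u with
  | inl _ => false | inr q => (tag q == e) && (k < (tagged q).+1 <= k') end.
have Ae j : j <= len e -> A (point e j) = (k < j <= k').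
  case/path_point_cases=> [->//|->|[i -> ->]]; last by rewrite /= eqxx.
  by rewrite path_point_last /=; apply/esym/negbTE; have := ltn_ord k'; lia.
have Ae' f j : f != e -> j <= len f -> A (point f j) = false.
  move=> fe /path_point_cases[->//|->|[i -> ->]]; last by rewrite /= (negPf fe).
  by rewrite path_point_last.
apply/cut_setP; exists A; split.
  exists (inl (ends e).1), (point e k'); rewrite Ae ?lkk' ?leqnn //.
  exact/ltnW/ltn_ord.
case=> f j fjX; have jl := ltn_ord j; change (A (point f j) = A (point f j.+1)).
case: (eqVneq f e) => [fe|fe]; last by rewrite !Ae' // ltnW.
case: e / fe k k' dX d'X nkk' lkk' A Ae Ae' => k k' dX d'X nkk' lkk' A Ae Ae'.
rewrite !Ae ?(ltnW jl) //.
have : j != k :> nat by apply: contra fjX => /eqP/val_inj->.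
have : j != k' :> nat by apply: contra fjX => /eqP/val_inj->.
lia.
Qed.

(** Tells whether the chain is already broken before its point at distance [j]. *)
Definition hit (X : {set edge H}) e j :=
  [exists i : 'I_(len e), (i < j) && (Tagged (fun e => 'I_(len e)) i \in X)].

Lemma hitS (X : {set edge H}) e (j : 'I_(len e)) :
  Tagged (fun e => 'I_(len e)) j \notin X -> hit X e j.+1 = hit X e j.
Proof.
move=> jX; apply: eq_existsb => i; rewrite ltnS leq_eqVlt.
by case: eqP => [/val_inj->|//]; rewrite (negPf jX) !andbF.
Qed.

Lemma hit_len (X : {set edge H}) e :
  hit X e (len e) = (e \in [set tag d | d in X]).
Proof.
apply/existsP/imsetP=> [[i /andP[_ iX]]|[[f i] fX ->]].
  by exists (Tagged (fun e => 'I_(len e)) i).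
by exists i; rewrite ltn_ord.
Qed.

(** A colouring of [S] extends along each chain: inner points take the colour of the first end up to
    the first failed edge, and that of the last end afterwards. *)
Lemma cut_set_lift (X : {set edge H}) : cut_set [set tag d | d in X] -> cut_set X.
Proof.
case/cut_setP=> A [[x [y Axy]] AX].
pose B (u : vertex H) := match u with
  | inl v => A v
  | inr q => if hit X (tag q) (tagged q).+1 then A (ends (tag q)).2
             else A (ends (tag q)).1 end.
have Bp e j : j <= len e ->
    B (point e j) = if hit X e j then A (ends e).2 else A (ends e).1.
  case/path_point_cases=> [->|->|[i -> ->]] //.
    by rewrite path_point0 /=; case: ifP => // /existsP[i]; rewrite ltn0.
  by rewrite path_point_last /= hit_len; case: ifPn => // /AX.
apply/cut_setP; exists B; split; first by exists (inl x), (inl y).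
case=> e j ejX; change (B (point e j) = B (point e j.+1)).
by rewrite !Bp ?ltn_ord // 1?ltnW ?ltn_ord // hitS.
Qed.

(** On a chain broken at most once every inner point stays attached to an end, so a colouring of the
    subdivision is still not constant on the vertices of [S]. *)
Lemma cut_set_proj (X : {set edge H}) :
  thin X -> cut_set X -> cut_set [set tag d | d in X].
Proof.
move=> /thinP thX /cut_setP[A [[x [y Axy]] AX]].
have step e j1 j2 : j1 <= j2 <= len e ->
    (forall i : 'I_(len e), j1 <= i < j2 -> Tagged (fun e => 'I_(len e)) i \notin X) ->
    A (point e j1) = A (point e j2).
  elim: j2 => [|j2 IH] /andP[j12 j2l] noX.
    by move: j12; rewrite leqn0 => /eqP->.
  case: (ltngtP j1 j2.+1) j12 => // [j12|->//] _.
  rewrite IH; first 1 last.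
  - by rewrite -ltnS j12 ltnW.
  - by move=> i /andP[h1 h2]; apply: noX; rewrite h1 ltnW.
  by have := AX (Tagged (fun e => 'I_(len e)) (Ordinal j2l)); apply; apply: noX; rewrite /= ltnSn andbT.
(* If the chain is broken before the point, thinness leaves the rest of the chain up to the last end
   intact; otherwise the point is tied to the first end. *)
have toend u : exists v, A u = A (inl v).
  case: u => [v|[e i]]; first by exists v.
  rewrite -(path_pointS i); have il : i.+1 <= len e by have := ltn_ord i; lia.
  case: (boolP (hit X e i.+1)) => [/existsP[h /andP[hi hX]]|/existsPn nohit].
    exists (ends e).2; rewrite -path_point_last; apply: step; first by rewrite il leqnn.
    move=> h' /andP[ih' _]; apply/negP=> h'X.
    have /eqP := thX _ _ hX h'X erefl; rewrite eq_Tagged /= => /eqP hh'.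
    by move: hi; rewrite hh' ltnNge ih'.
  exists (ends e).1; rewrite -path_point0; apply/esym/step => //.
  move=> h /= hi; apply/negP => hX; have := nohit h; by rewrite hX hi.
apply/cut_setP; exists (fun v => A (inl v)); split.
  have [v Av] := toend x; have [w Aw] := toend y.
  by exists v, w; rewrite -Av -Aw.
move=> e eX; rewrite -path_point0 -path_point_last; apply: step; first by rewrite leqnn.
move=> i _; apply: contra eX => iX; exact: (imset_f _ iX).
Qed.

Lemma cut_set_subdivide (X : {set edge H}) :
  cut_set X = ~~ thin X || cut_set [set tag d | d in X].
Proof.
case: (boolP (thin X)) => [tX|/cut_set_not_thin->//] /=.
by apply/idP/idP; [exact: cut_set_proj | exact: cut_set_lift].
Qed.

(** A thin set is a choice function on the chains, with value [None] on untouched chains and the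
    failed position on those of [Y]. *)
Lemma card_thin (Y : {set edge S}) :
  #|[set X : {set edge H} | thin X & [set tag d | d in X] == Y]|
    = \prod_(e in Y) len e.
Proof.
pose T e := option 'I_(len e).
pose F e : pred (T e) := if e \in Y then predC1 None else pred1 None.
pose phi (f : {dffun forall e, T e}) : {set edge H} :=
  [set d | f (tag d) == Some (tagged d)].
have phi_inj : injective phi.
  move=> f g fg; apply/ffunP => e.
  have eqi i : (f e == Some i) = (g e == Some i).
    by have /setP/(_ (Tagged (fun e => 'I_(len e)) i)) := fg; rewrite !inE.
  case fe: (f e) => [i|]; first by have := eqi i; rewrite fe eqxx => /esym/eqP.
  by case ge: (g e) => [i|//]; have := eqi i; rewrite fe ge eqxx.
have -> : [set X : {set edge H} | thin X & [set tag d | d in X] == Y]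
          = phi @: family F.
  apply/setP=> X; rewrite inE; apply/andP/imsetP => [[/thinP tX /eqP XY]|[f fF ->]].
    exists [ffun e => [pick i | Tagged (fun e => 'I_(len e)) i \in X] : T e].
      apply/familyP => e; rewrite /F ffunE -XY.
      case: ifPn => [/imsetP[[e' i] iX /= ee']|nE]; case: pickP => [j jX|noi] //.
        by case: e' / ee' i iX => i iX; have := noi i; rewrite iX.
      by case/imsetP: nE; exists (Tagged (fun e => 'I_(len e)) j).
    apply/setP=> -[e i]; rewrite inE ffunE /=.
    case: pickP => [j jX|noi]; last by rewrite noi.
    rewrite (inj_eq Some_inj); apply/idP/eqP => [iX|<-//].
    by have /eqP := tX _ _ jX iX erefl; rewrite eq_Tagged /= => /eqP.
  split.
    apply/thinP=> -[e i] [e' j]; rewrite !inE /= => /eqP fi fj ee'.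
    by case: e' / ee' j fj => j; rewrite fi => /eqP[->].
  apply/eqP/setP=> e; have /familyP/(_ e) := fF; rewrite /F.
  case: ifPn => eY; rewrite inE.
    case fe: (f e) => [i|//] _; apply/imsetP.
    by exists (Tagged (fun e => 'I_(len e)) i); rewrite // inE /= fe.
  move=> /eqP fe; apply/negbTE/imsetP=> -[[e' i]]; rewrite inE /= => /eqP fi ee'.
  by case: e' / ee' i fi => i; rewrite fe.
rewrite card_imset // card_family foldrE big_map big_enum /=.
rewrite [RHS]big_mkcond /=; apply: eq_bigr => e _; rewrite /F.
case: ifP => _; last by rewrite card1.
by have := cardC (pred1 (None : T e)); rewrite card1 card_option card_ord add1n => -[].
Qed.

Lemma intact_subdivide k :
  intact H k = \sum_(Y : {set edge S} | ~~ cut_set Y && (#|Y| == k)) \prod_(e in Y) len e.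
Proof.
rewrite /intact -sum1_card.
rewrite (partition_big (fun X : {set edge H} => [set tag d | d in X])
  (fun Y => ~~ cut_set Y && (#|Y| == k))) /=; last first.
  move=> X /[!inE]; rewrite cut_set_subdivide negb_or negbK.
  by case/andP=> /andP[/thinP tX ->] /eqP<- /=; rewrite card_in_imset // eqxx.
apply: eq_bigr => Y /andP[cY /eqP kY]; rewrite -card_thin -sum1_card.
apply: eq_bigl => X; rewrite !inE cut_set_subdivide negb_or negbK -andbA.
case: (boolP (thin X)) => //= /thinP tX.
case: (_ =P Y) => [XY|_]; rewrite ?andbF ?andbT //.
by rewrite XY cY -kY -XY card_in_imset //= eqxx.
Qed.
End SubdivideTheory.

(** * Suppressing vertices of degree 2 *)

(** An entry found in two of the lists, or twice in one, would have total multiplicity at least 2.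
    This gives injectivity of the maps from a subdivision back to [G], on vertices and on edges. *)
Lemma index_unique (I : finType) (T : eqType) (m : I -> seq T) (x0 x0' : T) i j k l :
    (forall x, \sum_i count_mem x (m i) <= 1) ->
    k < size (m i) -> l < size (m j) -> nth x0 (m i) k = nth x0' (m j) l ->
  i = j /\ k = l.
Proof.
move=> m1 kl ll eq_kl; have le1 := m1 (nth x0 (m i) k).
have mi : 0 < count_mem (nth x0 (m i) k) (m i).
  by rewrite -has_count has_pred1 mem_nth.
have mj : 0 < count_mem (nth x0 (m i) k) (m j).
  by rewrite eq_kl -has_count has_pred1 mem_nth.
case: (eqVneq i j) => ij; last first.
  move: le1; rewrite (bigD1 i) // (bigD1 j) 1?eq_sym //=; lia.
split=> //; case: j / ij l ll eq_kl mj => l ll eq_kl _.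
rewrite (set_nth_default x0) // in eq_kl.
apply/eqP; rewrite -(nth_uniq x0 kl ll) ?eq_kl //.
apply: count_mem_uniq => x; have := m1 x; rewrite (bigD1 i) //=.
by case: (boolP (x \in m i)) => [|/count_memPn->//]; rewrite -has_pred1 has_count; lia.
Qed.

Lemma inj_surj_bij (A B : finType) (f : A -> B) :
  injective f -> (forall y, exists x, f x = y) -> bijective f.
Proof.
move=> fi fs; apply: inj_card_bij => //.
rewrite -(card_codom fi) subset_leq_card //.
by apply/subsetP=> y _; have [x <-] := fs y; apply: codom_f.
Qed.

Section Trails.
Variable G : mgraph.
Local Notation V := (vertex G).
Local Notation E := (edge G).

Fixpoint joined_by (x : V) (mid : seq V) (es : seq E) (y : V) : bool :=
  match mid, es with
  | [::], [:: e] => joins e x y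
  | v :: mid', e :: es' => joins e x v && joined_by v mid' es' y
  | _, _ => false
  end.

Lemma joined_by_cat x m1 es1 v m2 es2 y :
  joined_by x m1 es1 v -> joined_by v m2 es2 y ->
  joined_by x (m1 ++ v :: m2) (es1 ++ es2) y.
Proof.
move=> h1 h2; elim: m1 x es1 h1 => [|w m1 IH] x [|e es1] //=.
  by case: es1 => //= ->.
by case/andP=> -> /IH.
Qed.

Lemma joined_by_rev x m es y :
  joined_by x m es y -> joined_by y (rev m) (rev es) x.
Proof.
elim: m x es => [|w m IH] x [|e es] //=.
  by case: es => //= h; rewrite joins_sym.
case/andP=> h /IH h'; rewrite !rev_cons -!cats1; apply: joined_by_cat h' _.
by rewrite /= joins_sym.
Qed.

Lemma joined_by_size x m es y : joined_by x m es y -> size es = (size m).+1.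
Proof.
elim: m x es => [|w m IH] x [|e es] //=; first by case: es.
by case/andP=> _ /IH->.
Qed.

Lemma joined_by_nth v0 e0 x m es y k : joined_by x m es y -> k < size es ->
  joins (nth e0 es k) (nth v0 (x :: rcons m y) k) (nth v0 (rcons m y) k).
Proof.
elim: m x es k => [|w m IH] x [|e es] k //=.
  by case: es => //= h; case: k.
by case/andP=> h h'; case: k => [|k] //; rewrite ltnS => /(IH _ _ _ h').
Qed.

(* A trail records its two ends, its inner vertices and its edges. *)
Definition trail : Type := V * V * (seq V * seq E).

Definition trail_ok (t : trail) := joined_by t.1.1 t.2.1 t.2.2 t.1.2.

Definition end_count (D : seq trail) v :=
  \sum_(t <- D) ((t.1.1 == v) + (t.1.2 == v)).
Definition inner_count (D : seq trail) v := \sum_(t <- D) count_mem v t.2.1.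
Definition edge_count (D : seq trail) e := \sum_(t <- D) count_mem e t.2.2.

(** The invariant of the merging process: the trails partition the edges, an inner occurrence
    accounts for degree 2, and a vertex is inner at most once and never both inner and an end. *)
Definition trail_decomposition (D : seq trail) : Prop :=
  [/\ all trail_ok D,
      forall e, edge_count D e = 1,
      forall v, degree v = end_count D v + 2 * inner_count D v &
      forall v, inner_count D v <= 1 /\ inner_count D v * end_count D v = 0].

Lemma perm_decomposition D D' :
  perm_eq D D' -> trail_decomposition D -> trail_decomposition D'.
Proof.
move=> DD' [h1 h2 h3 h4].
have e1 v : end_count D v = end_count D' v by apply: perm_big.
have e2 v : inner_count D v = inner_count D' v by apply: perm_big.
split=> [|e|v|v].
- by rewrite -(perm_all _ DD').
- by rewrite -(h2 e); apply/esym/perm_big.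
- by rewrite -e1 -e2.
- by rewrite -e1 -e2.
Qed.

Definition rev_trail (t : trail) : trail := (t.1.2, t.1.1, (rev t.2.1, rev t.2.2)).

Lemma rev_decomposition t D :
  trail_decomposition (t :: D) -> trail_decomposition (rev_trail t :: D).
Proof.
case: t => -[x y] [m es] [/= /andP[h1 h1'] h2 h3 h4].
have e1 v : end_count ((x, y, (m, es)) :: D) v =
            end_count (rev_trail (x, y, (m, es)) :: D) v.
  by rewrite /end_count !big_cons /= [X in X + _]addnC.
have e2 v : inner_count ((x, y, (m, es)) :: D) v =
            inner_count (rev_trail (x, y, (m, es)) :: D) v.
  by rewrite /inner_count !big_cons /= count_rev.
split=> [|e|v|v].
- by rewrite /= h1' andbT; apply: joined_by_rev.
- by rewrite -(h2 e) /edge_count !big_cons /= count_rev.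
- by rewrite -e1 -e2.
- by rewrite -e1 -e2.
Qed.

(** The two ends at [v] are the only ones, so after the merge [v] is no end any more and may become
    an inner vertex. *)
Lemma merge_decomposition x v y m1 es1 m2 es2 D :
    end_count ((x, v, (m1, es1)) :: (v, y, (m2, es2)) :: D) v = 2 ->
    trail_decomposition ((x, v, (m1, es1)) :: (v, y, (m2, es2)) :: D) ->
  trail_decomposition ((x, y, (m1 ++ v :: m2, es1 ++ es2)) :: D).
Proof.
set D2 := _ :: _ => dv; set D1 := (_ :: D).
case=> [/= /and3P[ok1 ok2 okD] h2 h3 h4].
have e1 w : end_count D2 w = end_count D1 w + 2 * (v == w).
  rewrite /end_count /D1 /D2 !big_cons /=; lia.
have e2 w : inner_count D1 w = inner_count D2 w + (v == w).
  rewrite /inner_count /D1 /D2 !big_cons /= count_cat /=; lia.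
split=> [|e|w|w].
- by rewrite /= okD andbT; apply: joined_by_cat ok1 ok2.
- by rewrite -(h2 e) /edge_count !big_cons /= count_cat addnA.
- rewrite h3 e1 e2; lia.
- have [] := h4 w; rewrite e2; have := e1 w.
  case: eqP => [<-|_]; last by rewrite !muln0 !addn0 => <-.
  rewrite dv; lia.
Qed.

Definition edge_trail (e : E) : trail := ((ends e).1, (ends e).2, ([::], [:: e])).

Lemma trivial_decomposition : trail_decomposition [seq edge_trail e | e <- enum E].
Proof.
have e2 v : inner_count [seq edge_trail e | e <- enum E] v = 0.
  by rewrite /inner_count big_map big1.
split=> [|e|v|v].
- by apply/allP=> _ /mapP[e _ ->]; apply: joins_ends.
- rewrite /edge_count big_map big_enum /= (bigD1 e) //= eqxx big1 // => f fe.
  by rewrite (negPf fe).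
- by rewrite e2 /end_count /degree big_map big_enum /= addn0.
- by rewrite e2.
Qed.

(** Since no trail is closed at [v], its two ends belong to two different trails; reversing them if
    necessary, the first arrives at [v] and the second departs from it, and they merge. *)
Lemma joined_at_degree2 D v : trail_decomposition D -> end_count D v = 2 ->
    (forall t, t \in D -> ~~ ((t.1.1 == v) && (t.1.2 == v))) ->
  exists2 D', trail_decomposition D' & size D' < size D.
Proof.
move=> dD dv noloop.
have pick_end (D0 : seq trail) : 0 < end_count D0 v ->
    exists2 t, t \in D0 & (t.1.1 == v) || (t.1.2 == v).
  move=> D0v; apply/hasP; apply: contraLR D0v => /hasPn nD0.
  by rewrite -eqn0Ngt /end_count big1_seq // => t /nD0; do 2!case: eqP.
have [|t1 t1D t1v] := pick_end D; first by rewrite dv.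
have p1 := perm_to_rem t1D; set D1 := rem t1 D in p1.
have dv1 : end_count (t1 :: D1) v = 2 by rewrite -dv; apply/esym/perm_big.
have [|t2 t2D t2v] := pick_end D1.
  have : (t1.1.1 == v) + (t1.1.2 == v) + end_count D1 v = 2.
    by rewrite -dv1 [RHS]/end_count big_cons.
  by move: t1v (noloop _ t1D); do 2!case: eqP => //=; lia.
have p2 := perm_to_rem t2D; set D2 := rem t2 D1 in p2.
have p : perm_eq D (t1 :: t2 :: D2).
  by apply: perm_trans p1 _; rewrite perm_cons.
have sD : size D = (size D2).+2 by rewrite (perm_size p).
have {}dD := perm_decomposition p dD.
have dv2 : end_count [:: t1, t2 & D2] v = 2 by rewrite -dv; apply/esym/perm_big.
have [t1' [dD1 dv1' t1'v]] : exists t1', [/\ trail_decomposition [:: t1', t2 & D2],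
    end_count [:: t1', t2 & D2] v = 2 & t1'.1.2 = v].
  case/orP: t1v => /eqP t1v; last by exists t1.
  exists (rev_trail t1); split=> //; first exact: rev_decomposition.
  by rewrite -dv2 /end_count !big_cons /= [X in X + _]addnC.
have [t2' [dD2 dv2' t2'v]] : exists t2', [/\ trail_decomposition [:: t1', t2' & D2],
    end_count [:: t1', t2' & D2] v = 2 & t2'.1.1 = v].
  case/orP: t2v => /eqP t2v; first by exists t2.
  exists (rev_trail t2); split=> //; last first.
    by rewrite -dv1' /end_count !big_cons /= [X in _ + (X + _)]addnC.
  have sw s t (D0 : seq trail) : perm_eq [:: s, t & D0] [:: t, s & D0].
    by rewrite -cat1s -(cat1s t) -(cat1s s) -[X in perm_eq _ X]cat1s perm_catCA.
  by apply/(perm_decomposition (sw _ _ _))/rev_decomposition/(perm_decomposition (sw _ _ _)).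
move: t1'v t2'v dD2 dv2'; case: t1' {dD1 dv1'} => -[x1 y1] [m1 es1].
case: t2' => -[x2 y2] [m2 es2] /= -> -> dD2 dv2'.
by have := merge_decomposition dv2' dD2; eexists; [eassumption|rewrite sD].
Qed.

(** Starting from single edges, each merge shortens the list; when none is possible, a vertex with
    end count 2 carries a closed trail. *)
Lemma reduced_decomposition : exists2 D, trail_decomposition D &
  forall v, end_count D v = 2 ->
    exists2 t, t \in D & (t.1.1 == v) && (t.1.2 == v).
Proof.
have := trivial_decomposition; move: [seq _ | _ <- _] => D.
have [n] := ubnP (size D); elim: n D => // n IH D Dn dD.
case: (boolP [exists v, (end_count D v == 2) &&
    ~~ has (fun t : trail => (t.1.1 == v) && (t.1.2 == v)) D]).
  case/existsP=> v /andP[/eqP dv /hasPn noloop].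
  have [D' dD' sD'] := joined_at_degree2 dD dv noloop.
  by apply: (IH D') dD'; apply: leq_trans sD' _; rewrite -ltnS.
move/existsPn=> h; exists D => // v dv; apply/hasP.
by have := h v; rewrite dv eqxx /= negbK.
Qed.

Section Base.
Variable D : seq trail.
Hypothesis dD : trail_decomposition D.

Let tr (i : 'I_(size D)) : trail := tnth (in_tuple D) i.

Let trD i : tr i \in D.
Proof. exact: mem_tnth. Qed.

Let base_vertex : finType := {v : V | inner_count D v == 0}.

Lemma trail_end_outer t v : t \in D -> (t.1.1 == v) || (t.1.2 == v) ->
  inner_count D v == 0.
Proof.
move=> tD tv; have [_ _ _ /(_ v)[_ /eqP]] := dD.
rewrite muln_eq0 => /orP[//|]; rewrite /end_count.
by rewrite (big_rem t) //= addn_eq0 addn_eq0 !eqb0; case: eqP tv => //= _ ->.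
Qed.

Let base_ends i : base_vertex * base_vertex :=
  (exist _ (tr i).1.1 (trail_end_outer (trD i) (introT orP (or_introl (eqxx _)))),
   exist _ (tr i).1.2 (trail_end_outer (trD i) (introT orP (or_intror (eqxx _))))).

(** Each trail is contracted to one edge. The vertices are those inner to no trail, so isolated
    vertices of [G] survive. *)
Definition trail_base : mgraph := @MGraph base_vertex 'I_(size D) base_ends.

Definition trail_len (i : edge trail_base) := size (tr i).2.2.

Let trail_size i : size (tr i).2.2 = (size (tr i).2.1).+1.
Proof.
have [/allP/(_ _ (trD i)) ok _ _ _] := dD; exact: joined_by_size ok.
Qed.

Lemma trail_len_gt0 i : 0 < trail_len i.
Proof. by rewrite /trail_len trail_size. Qed.

Lemma trail_base_degree (v : vertex trail_base) :
  degree v = end_count D (val v).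
Proof. by rewrite /degree /end_count (big_tnth _ _ D). Qed.

Lemma trail_base_isomorphic : isomorphic G (subdivide trail_len).
Proof.
have [/allP ok h2 h3 h4] := dD; apply: isomorphic_sym.
(* The default of [nth] is never reached: inner indices are in range by [mid_lt] below. *)
pose f (u : vertex (subdivide trail_len)) : V := match u with
  | inl v => val v
  | inr q => nth (tr (tag q)).1.1 (tr (tag q)).2.1 (tagged q) end.
pose g (d : edge (subdivide trail_len)) : E :=
  tnth (in_tuple (tr (tag d)).2.2) (tagged d).
have inner1 v : \sum_i count_mem v (tr i).2.1 <= 1.
  by have [+ _] := h4 v; rewrite /inner_count (big_tnth _ _ D).
have edge1 e : \sum_i count_mem e (tr i).2.2 = 1.
  by have := h2 e; rewrite /edge_count (big_tnth _ _ D).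
have mid_lt i (k : 'I_(trail_len i).-1) : k < size (tr i).2.1.
  by apply: leq_trans (ltn_ord k) _; rewrite /trail_len trail_size.
have inner_mem i v : v \in (tr i).2.1 -> inner_count D v != 0.
  rewrite -has_pred1 has_count => vi.
  by rewrite /inner_count (big_tnth _ _ D) (bigD1 i) //= addn_eq0 negb_and -lt0n vi.
apply: (@isomorphic_suff _ _ f g).
- apply: inj_surj_bij => [[[v hv]|[i k]] [[w hw]|[j l]] /=|v].
  + by move=> vw; congr inl; apply: val_inj.
  + move=> vw; have /inner_mem : v \in (tr j).2.1 by rewrite vw mem_nth.
    by rewrite hv.
  + move=> vw; have /inner_mem : w \in (tr i).2.1 by rewrite -vw mem_nth.
    by rewrite hw.
  + move=> vw; have [ij kl] := index_unique inner1 (mid_lt _ _) (mid_lt _ _) vw.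
    by case: j / ij l kl {vw} => l /val_inj->.
  + case: (eqVneq (inner_count D v) 0) => [v0|].
      by exists (inl (exist _ v (introT eqP v0))).
    rewrite /inner_count (big_tnth _ _ D) sum_nat_eq0 negb_forall => /existsP[i] /=.
    rewrite -lt0n -has_count has_pred1 => vi.
    have kl : index v (tr i).2.1 < (trail_len i).-1.
      by rewrite /trail_len trail_size index_mem.
    exists (inr (Tagged (fun e => 'I_(trail_len e).-1) (Ordinal kl))).
    by rewrite /= nth_index.
- apply: inj_surj_bij => [[i k] [j l]|e].
    rewrite /g /= => kl; have e0 := tnth (in_tuple (tr i).2.2) k.
    rewrite !(tnth_nth e0) /= in kl.
    have [|||] := @index_unique _ _ (fun i => (tr i).2.2) e0 e0 i j k l _ _ _ kl.
    + by move=> e; rewrite edge1.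
    + exact: ltn_ord.
    + exact: ltn_ord.
    by move=> ij {}kl; case: j / ij l kl => l /val_inj->.
  have : \sum_i count_mem e (tr i).2.2 != 0 by rewrite edge1.
  rewrite sum_nat_eq0 negb_forall => /existsP[i] /=.
  rewrite -lt0n -has_count has_pred1 => ei.
  have kl : index e (tr i).2.2 < trail_len i by rewrite index_mem.
  exists (Tagged (fun e => 'I_(trail_len e)) (Ordinal kl)).
  by rewrite /g /= (tnth_nth e) /= nth_index.
have fp i k : k <= trail_len i -> f (path_point trail_len i k)
    = nth (tr i).1.1 ((tr i).1.1 :: rcons (tr i).2.1 (tr i).1.2) k.
  case/path_point_cases => [->//|->|[j -> ->]].
    rewrite (path_point_last trail_len_gt0).
    by rewrite (trail_size i : trail_len i = _) /= nth_rcons ltnn eqxx.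
  by rewrite /= nth_rcons mid_lt.
case=> i k; have kl := ltn_ord k.
change (joins (g (Tagged (fun e => 'I_(trail_len e)) k))
  (f (path_point trail_len i k)) (f (path_point trail_len i k.+1))).
rewrite !fp ?(ltnW kl) // /g (tnth_nth (tnth (in_tuple (tr i).2.2) k)) /=.
by apply: joined_by_nth kl; apply: ok.
Qed.
End Base.

(** A vertex of degree 2 can remain only on a cycle component, which shrinks to a single loop. *)
Lemma suppress_degree2 : exists (S : mgraph) (len : edge S -> nat),
  [/\ forall e, 0 < len e, isomorphic G (subdivide len) &
      forall v : vertex S, degree v = 2 -> exists e, ends e = (v, v)].
Proof.
have [D dD loops] := reduced_decomposition.
exists (trail_base dD), (@trail_len _ dD); split.
- exact: trail_len_gt0.
- exact: trail_base_isomorphic.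
move=> v; rewrite trail_base_degree => /loops[t tD /andP[/eqP t1 /eqP t2]].
have il : index t D < size D by rewrite index_mem.
exists (Ordinal il); rewrite /=; congr (_, _); apply: val_inj => /=;
  by rewrite (tnth_nth t) /= nth_index.
Qed.
End Trails.

(** * Cubic structure from balanced chains *)

Lemma handshake G : \sum_(v : vertex G) degree v = 2 * #|edge G|.
Proof.
rewrite exchange_big /= -sum1_card big_distrr /=; apply: eq_bigr => e _.
have one (x : vertex G) : \sum_v ((x == v) : nat) = 1.
  rewrite (bigD1 x) //= eqxx big1 // => v; by rewrite eq_sym => /negPf->.
by rewrite big_split /= !one.
Qed.

(** If [v] is not the only vertex, the non-loop edges at [v] form a cut, so there are at least two;
    a degree below 3 is then exactly 2, and the loop required at [v] would add 2 more. If [v] is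
    alone, all edges are loops and there are at least two. *)
Lemma min_degree3 G : ~~ cut_set (set0 : {set edge G}) ->
    (forall e : edge G, ~~ cut_set [set e]) -> #|vertex G| < #|edge G| ->
    (forall v : vertex G, degree v = 2 -> exists e, ends e = (v, v)) ->
  forall v : vertex G, 3 <= degree v.
Proof.
move=> nc0 nc1 ltVE loops v; rewrite leqNgt; apply/negP => dv.
case: (boolP [exists w, w != v]) => [/existsP[w wv]|/existsPn onev]; last first.
  have V1 : vertex G =i pred1 v by move=> w; have := onev w; rewrite !inE negbK.
  have := handshake G; rewrite (eq_bigl (pred1 v)) => [|w]; last first.
    by have := V1 w; rewrite !inE.
  rewrite big_pred1_eq => hs.
  by move: ltVE; rewrite (eq_card V1) card1; lia.
pose inc e := ((ends e).1 == v) + ((ends e).2 == v).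
pose X := [set e | inc e == 1].
have cX : cut_set X.
  apply/cut_setP; exists (fun z => z == v); split.
    by exists v, w; rewrite eqxx (negPf wv).
  by move=> e; rewrite inE /inc; case: ((ends e).1 == v); case: ((ends e).2 == v).
have X2 : 1 < #|X|.
  rewrite ltnNge leq_eqVlt ltnS leqn0; apply/negP => /orP[/cards1P[e Xe]|].
    by have := nc1 e; rewrite -Xe cX.
  by rewrite cards_eq0 => /eqP X0; move: nc0; rewrite -X0 cX.
have leXd : \sum_(e in X) inc e <= degree v.
  by rewrite [degree v](bigID (mem X)) /= leq_addr.
have sX : \sum_(e in X) inc e = #|X|.
  by rewrite -sum1_card; apply: eq_bigr => e; rewrite inE => /eqP.
have d2 : degree v = 2 by lia.
have [e0 e0v] := loops v d2.
have : 2 + \sum_(e in X) inc e <= degree v.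
  rewrite [degree v](bigID (mem X)) /= addnC leq_add2l.
  by rewrite (bigD1 e0) ?inE /inc e0v /= !eqxx.
lia.
Qed.

(** The elementary symmetric polynomial of degree [k] in the values of [f]. *)
Definition esym (I : finType) (f : I -> nat) (k : nat) : nat :=
  \sum_(Y : {set I} | #|Y| == k) \prod_(i in Y) f i.

(** Newton's identity in degree 2, by counting each two-element set once from each of its
    elements. *)
Lemma esym2_square_sum (I : finType) (f : I -> nat) :
  2 * esym f 2 + \sum_i f i ^ 2 = (\sum_i f i) ^ 2.
Proof.
have pairs i : \sum_(Y : {set I} | (#|Y| == 2) && (i \in Y)) \prod_(j in Y) f j
    = \sum_(j | j != i) f i * f j.
  have setP2 (Y : {set I}) : (#|Y| == 2) && (i \in Y) -> exists2 j, j != i & Y = [set i; j].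
    case/andP=> /cards2P[a [b [ab ->]]] /set2P[->|->].
      by exists b; rewrite // eq_sym.
    by exists a; rewrite // setUC.
  pose other (Y : {set I}) := odflt i [pick j in Y :\ i].
  have otherE j : j != i -> other [set i; j] = j.
    move=> ji; rewrite /other; case: pickP => [x|/(_ j)]; last by rewrite !inE eqxx orbT ji.
    by rewrite !inE; case: eqP => //= _ /eqP.
  rewrite (reindex_onto (fun j => [set i; j]) other) /=; last first.
    by move=> Y /setP2[j ji ->]; rewrite otherE.
  apply: eq_big => [j|j].
    case: (eqVneq j i) => [->|ji]; first by rewrite cards2 eqxx.
    by rewrite otherE // cards2 [i == j]eq_sym ji !inE !eqxx.
  case/andP=> /andP[h _] _; have ji : i != j by move: h; rewrite cards2; case: (i == j).
  by rewrite big_setU1 ?inE //= big_set1.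
have -> : 2 * esym f 2 = \sum_i \sum_(j | j != i) f i * f j.
  under [RHS]eq_bigr => i _ do rewrite -pairs.
  rewrite (exchange_big_dep (fun Y : {set I} => #|Y| == 2)) /=; last by move=> ? ? _ /andP[].
  rewrite /esym big_distrr /=; apply: eq_bigr => Y /eqP Y2.
  by rewrite (eq_bigl (mem Y)) => [|i]; rewrite ?Y2 ?eqxx // sum_nat_const Y2.
rewrite -big_split /= -mulnn big_distrl /=; apply: eq_bigr => i _.
by rewrite big_distrr /= [RHS](bigD1 i) //= addnC -mulnn.
Qed.

Lemma intact_full G k : intact G k = 'C(#|edge G|, k) ->
  forall X : {set edge G}, #|X| = k -> ~~ cut_set X.
Proof.
have := cuts_intact G k => ci ik X Xk; apply/negP => cX.
have : cuts G k = 0 by lia.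
by move/eqP; rewrite cards_eq0 => /eqP/setP/(_ X); rewrite !inE cX Xk eqxx.
Qed.

Lemma cubic_card_edge r lambda M : is_cubic_marked r lambda M ->
  #|edge (base M)| = 3 * (r - 1).
Proof.
case=> cub card _; have := handshake (base M).
by rewrite (eq_bigr (fun=> 3)) // sum_nat_const card; lia.
Qed.

(* [(l - c) (l - c - 1) >= 0] for integers, with equality only if l is c or
   c + 1: summed over the chains, it forces the number of chains to be maximal
   and their lengths to be balanced. *)
Lemma balanced_square_le c l : (2 * c + 1) * l <= l ^ 2 + c * c.+1.
Proof.
case: (leqP l c) => h.
  by have [d ->] : exists d, c = l + d; [exists (c - l); lia | nia].
by have [d ->] : exists d, l = c.+1 + d; [exists (l - c.+1); lia | nia].
Qed.

Lemma balanced_square_eq c l : (2 * c + 1) * l = l ^ 2 + c * c.+1 -> l = c \/ l = c.+1.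
Proof.
case: (leqP l c) => h.
  have [d ->] : exists d, c = l + d by exists (c - l); lia.
  by case: d => [|d]; [left; lia | nia].
have [d ->] : exists d, l = c.+1 + d by exists (l - c.+1); lia.
by case: d => [|d]; [right; lia | nia].
Qed.

(** The last hypothesis says that [G] has at least as many non-cut pairs as the second elementary
    symmetric function of [3 * (r - 1)] balanced lengths. *)
Lemma balanced_cubic_structure (r c lambda : nat) (G : mgraph) :
    2 <= r -> 1 <= c ->
    #|edge G| = c * (3 * (r - 1)) + lambda -> #|vertex G| + r = #|edge G| + 1 ->
    intact G 0 = 1 -> intact G 1 = #|edge G| ->
    #|edge G| ^ 2 + 3 * (r - 1) * (c * c.+1)
      <= 2 * intact G 2 + (2 * c + 1) * #|edge G| ->
  exists M, is_cubic_marked r lambda M /\ isomorphic G (expand M c).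
Proof.
move=> r2 c1 mE nE i0 i1 i2.
have [S [len [len_gt0 iso loops]]] := suppress_degree2 G.
have [f [g [bf bg _]]] := iso.
have EG := bij_eq_card bg; have VG := bij_eq_card bf.
rewrite !(isomorphic_intact _ iso) in i0 i1 i2.
have EH : #|edge (subdivide len)| = \sum_e len e := card_edge_subdivide len.
have VH : #|vertex (subdivide len)| = #|vertex S| + \sum_e (len e).-1 :=
  card_vertex_subdivide len.
have pred_sum : \sum_e (len e).-1 + #|edge S| = \sum_e len e.
  by rewrite -sum1_card -big_split /=; apply: eq_bigr => e _; have := len_gt0 e; lia.
(* Small cuts of [S] would lift to small cuts of [G]. *)
have nc0 : ~~ cut_set (set0 : {set edge S}).
  have : ~~ cut_set (set0 : {set edge (subdivide len)}).
    by apply: (@intact_full _ 0); rewrite ?cards0 // bin0.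
  by apply: contra => c0; apply: (cut_set_lift len_gt0); rewrite imset0.
have nc1 (e : edge S) : ~~ cut_set [set e].
  pose d : edge (subdivide len) := Tagged (fun e => 'I_(len e)) (Ordinal (len_gt0 e)).
  have : ~~ cut_set [set d].
    by apply: (@intact_full _ 1); rewrite ?cards1 // bin1 -EG.
  by apply: contra => ce; apply: (cut_set_lift len_gt0); rewrite imset_set1.
have VS : #|vertex S| + r = #|edge S| + 1 by lia.
have deg3 : forall v : vertex S, 3 <= degree v by apply: min_degree3 => //; lia.
have hs := handshake S.
have VS3 : 3 * #|vertex S| <= 2 * #|edge S|.
  by rewrite -hs mulnC -sum_nat_const leq_sum.
have sq := esym2_square_sum len; rewrite -EH -EG in sq.
have i2e : intact (subdivide len) 2 <= esym len 2.
  rewrite (intact_subdivide len_gt0) /esym [X in _ <= X](bigID (fun Y => cut_set Y)) /=.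
  by apply: leq_trans (leq_addl _ _); rewrite (eq_bigl _ _ (fun Y => andbC _ _)).
have sumle : (2 * c + 1) * #|edge G| <= \sum_e len e ^ 2 + #|edge S| * (c * c.+1).
  rewrite EG EH big_distrr -sum_nat_const -big_split /=.
  by apply: leq_sum => e _; apply: balanced_square_le.
(* The handshake bound gives at most [3 * (r - 1)] chains; [i2], [sq] and [sumle] give at least as
   many. *)
have ES : #|edge S| = 3 * (r - 1) by nia.
(* The termwise inequalities have equal sums, so each is an equality. *)
have len_eq e : (2 * c + 1) * len e = len e ^ 2 + c * c.+1.
  have : \sum_e (2 * c + 1) * len e = \sum_e (len e ^ 2 + c * c.+1).
    by rewrite -big_distrr big_split /= sum_nat_const -EH -EG; rewrite ES in sumle *; lia.
  move/eqP; rewrite eqn_leq => /andP[_]; rewrite leqNgt => /negP nlt.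
  apply/eqP; rewrite eqn_leq balanced_square_le leqNgt; apply/negP => lt_e.
  apply: nlt; rewrite (bigD1 e) //= [X in _ < X](bigD1 e) //= -addSn leq_add //.
  by apply: leq_sum => e' _; apply: balanced_square_le.
have VS2 : #|vertex S| = 2 * (r - 1) by lia.
pose L := [set e | len e == c.+1].
have lenL e : len e = if e \in L then c.+1 else c.
  by rewrite inE; have [->|->] := balanced_square_eq (len_eq e); case: eqP => // ; lia.
exists (MarkedStructure L); split; last first.
  by rewrite /expand /=; have <- : len = _ := funext lenL.
split=> /=; [|exact: VS2|]; last first.
  have : \sum_e len e = \sum_e (c + (e \in L)).
    by apply: eq_bigr => e _; rewrite {1}lenL; case: (e \in L); lia.
  rewrite big_split /= sum_nat_const -EH -EG mE ES.
  rewrite -big_mkcond /= sum1_card; lia.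
(* A degree above 3 would make the degree sum exceed [2 * #|edge S|]. *)
move=> v; apply/eqP; rewrite eqn_leq deg3 andbT leqNgt; apply/negP => dv.
have : \sum_(w : vertex S) 3 < \sum_(w : vertex S) degree w.
  rewrite (bigD1 v) //= [X in _ < X](bigD1 v) //= -addSn leq_add //.
  exact: leq_sum.
rewrite hs sum_nat_const VS2 ES; lia.
Qed.

(** * The Moebius ladder *)

Lemma uniq_size_card (T : finType) (s : seq T) (X : {set T}) :
  uniq s -> all (mem X) s -> size s <= #|X|.
Proof.
move=> us /allP sX; rewrite cardE; apply: uniq_leq_size => // x /sX.
by rewrite mem_enum.
Qed.

Section MoebiusLadder.
Variable q : nat.
Hypothesis q_gt0 : 0 < q.

(** A cycle of length [2q] with rungs between opposite vertices; for [q = 1], three parallel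
    edges. *)
Definition moebius_ladder : mgraph := @MGraph 'I_(q + q) ('I_(q + q) + 'I_q)%type
  (fun e => match e with
            | inl i => (i, ordS i)
            | inr i => (lshift q i, rshift q i)
            end).

Lemma moebius_ladder_cubic : cubic moebius_ladder.
Proof.
move=> v; rewrite /degree big_sumType /= big_split /=.
have one (x : 'I_(q + q)) : \sum_y ((y == x) : nat) = 1.
  by rewrite (bigD1 x) //= eqxx big1 // => y /negPf->.
have -> : \sum_i ((ordS i == v) : nat) = 1.
  by rewrite -(one v) [RHS](reindex_inj (can_inj (@ordSK _))).
rewrite one.
suff -> : \sum_(i < q) ((lshift q i == v) + (rshift q i == v)) = 1 by [].
by rewrite big_split -(one v) [RHS]big_split_ord.
Qed.

Let N_gt0 : 0 < q + q. Proof. by rewrite addn_gt0 q_gt0. Qed.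

Let pt (n : nat) : 'I_(q + q) := Ordinal (ltn_pmod n N_gt0).

Let ptS n : ordS (pt n) = pt n.+1.
Proof. by apply: val_inj; rewrite /= -addn1 modnDml addn1. Qed.

Let pt_val (i : 'I_(q + q)) : pt i = i.
Proof. by apply: val_inj; rewrite /= modn_small. Qed.

Let pt_inj a b : a < b < a + (q + q) -> pt a != pt b.
Proof.
case/andP=> ab bN; rewrite -val_eqE /= eq_sym eqn_mod_dvd; last exact: ltnW.
by apply/negP => /dvdn_leq; rewrite subn_gt0 ab => /(_ isT); lia.
Qed.

(** A non-constant colouring changes across at least three edges. If a rung changes colour, so does
    an edge of each arc between its ends. Otherwise the colouring has period [q] along the cycle,
    and a change at [i] recurs at [i + q], with a third one forced in between. *)
Lemma moebius_ladder_uncut (X : {set edge moebius_ladder}) :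
  #|X| <= 2 -> ~~ cut_set X.
Proof.
move=> X2; apply/negP => /cut_setP[A [[x [y Axy]] AX]].
pose F n := A (pt n).
have Fper n : F (n + (q + q)) = F n.
  by congr A; apply: val_inj; rewrite /= modnDr.
have changeX n : F n != F n.+1 -> inl (pt n) \in X.
  by apply: contraR => /AX /=; rewrite ptS => /eqP.
have change a b : a <= b -> F a != F b -> exists2 i, a <= i < b & F i != F i.+1.
  elim: b => [|b IH]; first by rewrite leqn0 => /eqP->; rewrite eqxx.
  rewrite leq_eqVlt => /orP[/eqP->|]; first by rewrite eqxx.
  rewrite ltnS => ab Fab; case: (eqVneq (F b) (F b.+1)) => [Fb|Fb].
    have [|i /andP[ai ib] Fi] := IH ab; first by rewrite Fb.
    by exists i; rewrite // ai ltnW.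
  by exists b; rewrite // ab ltnSn.
case: (boolP [exists k : 'I_q, F k != F (k + q)]) => [/existsP[k Fk]|/existsPn rungs].
  have kX : inr k \in X.
    apply: contraR Fk => /AX /=.
    have -> : lshift q k = pt k by apply: val_inj; rewrite /= modn_small //; have := ltn_ord k; lia.
    have -> : rshift q k = pt (k + q).
      by apply: val_inj; rewrite /= modn_small 1?addnC //; have := ltn_ord k; lia.
    by move/eqP.
  have [|i /andP[ki ikq] Fi] := change k (k + q) _ Fk; first exact: leq_addr.
  have [||j /andP[kj jkq] Fj] := change (k + q) (k + q + q).
  - exact: leq_addr.
  - by rewrite -addnA Fper eq_sym.
  have : size [:: inr k; inl (pt i); inl (pt j)] <= #|X|.
    apply: uniq_size_card; last by rewrite /= kX !changeX.
    rewrite /= !inE /= andbT; apply: pt_inj; lia.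
  by move/leq_trans/(_ X2).
have Fq k : k < q -> F (k + q) = F k.
  by move=> kq; have /negPn/eqP := rungs (Ordinal kq).
have FqS k : k < q -> F (k + q).+1 = F k.+1.
  rewrite leq_eqVlt => /orP[/eqP kq|kq]; last by rewrite -addSn Fq.
  (* Here [k + 1 = q] and the point wraps around to 0. *)
  by rewrite -addSn kq -[in LHS](add0n (q + q)) Fper -(Fq 0).
have [i iq Fi] : exists2 i, i < q & F i != F i.+1.
  have [i iN Fi] : exists2 i, i < q + q & F i != F i.+1.
    have Fxy : F x != F y by rewrite /F !pt_val.
    case: (leqP x y) => xy.
      by have [i /andP[_ iy] Fi] := change _ _ xy Fxy; exists i => //; apply: ltn_trans iy _.
    rewrite eq_sym in Fxy; have [i /andP[_ ix] Fi] := change _ _ (ltnW xy) Fxy.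
    by exists i => //; apply: ltn_trans ix _.
  case: (ltnP i q) => [iq|qi]; first by exists i.
  have iq : i - q < q by lia.
  by exists (i - q); rewrite // -(Fq _ iq) -(FqS _ iq) subnK.
have Fiq : F (i + q) != F (i + q).+1 by rewrite Fq ?FqS.
have Fi1 : F i.+1 != F (i + q) by rewrite Fq // eq_sym.
have [|j /andP[ij jiq] Fj] := change _ _ _ Fi1; first lia.
have := @uniq_size_card (edge moebius_ladder)
  [:: inl (pt i); inl (pt j); inl (pt (i + q))] X.
rewrite /= !changeX // => /(_ _ isT).
have ij' : pt i != pt j by apply: pt_inj; lia.
have jq : pt j != pt (i + q) by apply: pt_inj; lia.
have iq' : pt i != pt (i + q) by apply: pt_inj; lia.
by rewrite !inE /= negb_or ij' jq iq' => /(_ isT)/leq_trans/(_ X2).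
Qed.

Lemma exists_uncut_cubic : exists S : mgraph, [/\ cubic S, #|vertex S| = 2 * q &
  forall X : {set edge S}, #|X| <= 2 -> ~~ cut_set X].
Proof.
exists moebius_ladder; split; first exact: moebius_ladder_cubic.
  by rewrite /= card_ord mul2n addnn.
exact: moebius_ladder_uncut.
Qed.
End MoebiusLadder.

(** * Unreliability near zero *)

Section NearZero.
Local Open Scope ring_scope.
Variable R : realType.

Lemma unreliability_cuts (G : mgraph) (p : R) :
  unreliability G p =
    \sum_(k < #|edge G|.+1) (cuts G k)%:R * (p ^+ k * (1 - p) ^+ (#|edge G| - k)).
Proof.
rewrite /unreliability.
have card_lt (X : {set edge G}) : (#|X| < #|edge G|.+1)%N by rewrite ltnS max_card.
rewrite (partition_big (fun X : {set edge G} => Ordinal (card_lt X)) predT) //=.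
apply: eq_bigr => k _.
rewrite /cuts -[#|[set _ | _]|]sum1_card natr_sum big_distrl /=.
apply: eq_big => [X|X /andP[_ /eqP Xk]]; first by rewrite inE -val_eqE.
rewrite mul1r (bigID (mem X)) /= -Xk /=; congr (_ * _).
  by rewrite (eq_bigr (fun=> p)) ?prodr_const // => e ->.
rewrite (eq_bigr (fun=> 1 - p)) => [|e /negPf->//].
rewrite prodr_const; congr (_ ^+ _).
by have := cardC (mem X); rewrite /= => <-; rewrite addKn; apply: eq_card => e.
Qed.

(** The substitution [p = x / (1 + x)] gives [1 - p = 1 / (1 + x)], which turns the unreliability
    into a polynomial in [x] whose coefficients are the cut counts. *)
Lemma unreliability_scaled (G : mgraph) (x : R) : 0 < x ->
  unreliability G (x / (1 + x)) * (1 + x) ^+ #|edge G|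
    = \sum_(k < #|edge G|.+1) (cuts G k)%:R * x ^+ k.
Proof.
move=> x0; rewrite unreliability_cuts big_distrl; apply: eq_bigr => -[k /= km] _.
have x1 : 1 + x != 0 by rewrite gt_eqF // addr_gt0.
have -> : 1 - x / (1 + x) = (1 + x)^-1 by field.
rewrite -mulrA; congr (_ * _); rewrite expr_div_n exprVn.
rewrite ltnS in km; rewrite -{2}(subnKC km) exprD.
rewrite mulrACA mulVf ?expf_neq0 // mulr1 mulfVK ?expf_neq0 //.
Qed.

(** Coefficients are integers, so a first difference in the wrong direction costs at least [x ^ k],
    while the higher terms on the other side are at most [K * x ^ k.+1]. *)
Lemma lowest_coef_le (a b : nat -> nat) (m : nat) (e : R) : 0 < e ->
    (forall x : R, 0 < x <= e ->
      \sum_(k < m.+1) (a k)%:R * x ^+ k <= \sum_(k < m.+1) (b k)%:R * x ^+ k) ->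
  forall k, (k <= m)%N -> (forall i, (i < k)%N -> a i = b i) -> (a k <= b k)%N.
Proof.
move=> e0 le_ab k km eq_ab; rewrite leqNgt; apply/negP => ltba.
pose K : R := \sum_(i < m.+1) (b i)%:R.
have K0 : 0 <= K by apply: sumr_ge0 => i _; apply: ler0n.
(* This choice gives [K * x < 1] and [x <= 1]. *)
pose x := Order.min e (K + 1)^-1.
have K1 : 0 < K + 1 by rewrite ltr_wpDl.
have x0 : 0 < x by rewrite lt_min e0 invr_gt0.
have xe : x <= e by rewrite ge_min lexx.
have xK : x * (K + 1) <= 1.
  by rewrite -ler_pdivlMr // mul1r ge_min lexx orbT.
have x1 : x <= 1.
  by rewrite ge_min invf_le1 // lerDr K0 orbT.
have := le_ab x; rewrite x0 xe => /(_ isT).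
rewrite -(big_mkord predT (fun k => (a k)%:R * x ^+ k)).
rewrite -(big_mkord predT (fun k => (b k)%:R * x ^+ k)).
have split_at (f : nat -> R) : \sum_(0 <= i < m.+1) f i
    = \sum_(0 <= i < k) f i + (f k + \sum_(k.+1 <= i < m.+1) f i).
  by rewrite (big_cat_nat _ (n := k)) ?leqW //= [X in _ + X]big_ltn.
rewrite !split_at.
rewrite (eq_big_nat _ _ (F2 := fun i => (b i)%:R * x ^+ i)) => [|i /andP[_ ik]]; last first.
  by rewrite eq_ab.
rewrite lerD2l.
set Sa := \sum_(_ <= _ < _) _; set Sb := \sum_(_ <= _ < _) _ => le1.
have Sa0 : 0 <= Sa.
  by apply: sumr_ge0 => i _; rewrite mulr_ge0 ?ler0n // exprn_ge0 // ltW.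
have SbK : Sb <= K * x ^+ k.+1.
  rewrite /K -(big_mkord predT (fun i => (b i)%:R)) (big_cat_nat _ (n := k.+1)) //=.
  rewrite mulrDl -[leLHS]add0r lerD //.
    apply: mulr_ge0; last by rewrite exprn_ge0 // ltW.
    by apply: sumr_ge0 => i _; rewrite ler0n.
  rewrite big_distrl /= /Sb; apply: ler_sum_nat => i /andP[ki _].
  rewrite ler_wpM2l ?ler0n // -(subnKC ki) exprD ler_piMr ?exprn_ge0 ?exprn_ile1 // ltW //.
have xk : 0 < x ^+ k by rewrite exprn_gt0.
have : (b k)%:R + 1 <= (a k)%:R :> R by rewrite natr1 ler_nat.
rewrite exprS in SbK; move=> ab.
have : ((b k)%:R + 1) * x ^+ k <= ((b k)%:R + K * x) * x ^+ k.
  apply: le_trans (_ : (a k)%:R * x ^+ k <= _); first by rewrite ler_pM2r.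
  lra.
by rewrite ler_pM2r // lerD2l; lra.
Qed.

Lemma most_reliable_cuts (G H : mgraph) : most_reliable_near_zero R G ->
    #|vertex H| = #|vertex G| -> #|edge H| = #|edge G| ->
  forall k, (forall i, (i < k)%N -> cuts G i = cuts H i) -> (cuts G k <= cuts H k)%N.
Proof.
case=> p' /andP[p'0 _] best VH EH k eq_ab.
case: (leqP k #|edge G|) => km; last first.
  by have := cuts_intact G k; rewrite bin_small //; lia.
(* Since [x / (1 + x) <= x], the bound [p'] also serves for [x]. *)
apply: (@lowest_coef_le (cuts G) (cuts H) #|edge G| p' p'0) km eq_ab => x /andP[x0 xp'].
have := unreliability_scaled H x0; rewrite EH => <-.
rewrite -unreliability_scaled //.
have x1 : 0 < 1 + x by rewrite addr_gt0.
rewrite ler_pM2r ?exprn_gt0 //; apply: best => //.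
apply/andP; split; first by rewrite divr_ge0 // ltW.
by rewrite ler_pdivrMr // (le_trans xp') // ler_pMr // lerDl ltW.
Qed.
End NearZero.

(** * Cut sets of expanded structures *)

Section Gamma.
Variable M : marked_structure.
Local Notation E := (edge (base M)).
Local Notation L := (long M).

Lemma gamma_sum k j : gamma M k j =
  \sum_(Y : {set E} | cut_set Y && (#|Y| == k)) 'C(#|Y :&: L|, j).
Proof.
rewrite /gamma -sum1_card.
rewrite (partition_big (fun XJ : {set E} * {set E} => XJ.1)
  (fun Y => cut_set Y && (#|Y| == k))) /=; last first.
  by case=> X J /[!inE] /= /and4P[-> ->].
apply: eq_bigr => Y /andP[cY kY].
rewrite -cards_draws -sum1_card (reindex_onto (fun J => (Y, J)) snd) /=; last first.
  by case=> X J /= /andP[_ /eqP->].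
by apply: eq_bigl => J; rewrite !inE /= cY kY !eqxx !andbT.
Qed.

(** A crude count of all pairs of edge sets; what matters is that it does not involve [c], the
    future base. *)
Lemma gamma_le k j : gamma M k j <= 4 ^ #|E|.
Proof.
apply: leq_trans (max_card _) _.
have cE : #|{set E}| = 2 ^ #|E|.
  by rewrite -(cardsT E) -card_powerset; apply: eq_card => X; rewrite !inE subsetT.
by rewrite card_prod cE -expnMn.
Qed.

Definition chain_len c (e : E) := if e \in L then c.+1 else c.

(** The product is [c.+1 ^ a * c ^ (k - a)] with [a = #|Y :&: L|]; the binomial theorem expands the
    first factor. *)
Lemma prod_chain_len c k (Y : {set E}) : #|Y| = k ->
  \prod_(e in Y) chain_len c e = \sum_(j < k.+1) 'C(#|Y :&: L|, j) * c ^ (k - j).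
Proof.
move=> Yk; set a := #|Y :&: L|.
have ak : a <= k by rewrite -Yk subset_leq_card // subsetIl.
have ac : #|Y :\: L| = k - a by rewrite cardsD Yk.
have -> : \prod_(e in Y) chain_len c e = c.+1 ^ a * c ^ (k - a).
  rewrite (bigID (mem L)) /=; congr (_ * _).
    rewrite (eq_bigr (fun=> c.+1)) => [|e /andP[_ eL]]; last by rewrite /chain_len eL.
    by rewrite prod_nat_const /a; congr (_ ^ _); apply: eq_card => e; rewrite !inE.
  rewrite (eq_bigr (fun=> c)) => [|e /andP[_ /negPf eL]]; last by rewrite /chain_len eL.
  rewrite prod_nat_const -ac; congr (_ ^ _).
  by apply: eq_card => e; rewrite !inE andbC.
rewrite -addn1 expnDn big_distrl /=.
rewrite -[RHS](big_mkord predT (fun j => 'C(a, j) * c ^ (k - j))).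
rewrite [RHS](big_cat_nat _ (n := a.+1)) //= [X in _ + X]big_nat.
rewrite [X in _ + X]big1 ?addn0 => [|j /andP[aj _]]; last by rewrite bin_small.
rewrite big_mkord; apply: eq_bigr => j _; have ja := ltn_ord j.
rewrite exp1n muln1 -mulnA -expnD; congr (_ * _ ^ _); lia.
Qed.

(** The symmetric function sums over all sets of [k] chains: the non-cuts give the non-cut sets of
    the expansion, and the cuts, once expanded in powers of [c], give the [gamma] coefficients. *)
Lemma intact_expand c k : 0 < c ->
  intact (expand M c) k + \sum_(j < k.+1) gamma M k j * c ^ (k - j)
    = esym (chain_len c) k.
Proof.
move=> c0; rewrite intact_subdivide; last by move=> e; case: ifP.
rewrite /esym [RHS](bigID (fun Y => cut_set Y)) /= addnC; congr (_ + _); last first.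
  by apply: eq_bigl => Y; rewrite andbC.
under eq_bigr => j _ do rewrite gamma_sum big_distrl /=.
rewrite exchange_big; apply: eq_big => [Y|Y /andP[_ /eqP Yk]]; first by rewrite andbC.
by rewrite (prod_chain_len _ Yk).
Qed.
End Gamma.

(** * Elementary symmetric functions of two-valued families *)

Section TwoValued.
Local Open Scope ring_scope.

Lemma esym_coef (I : finType) (f : I -> nat) k :
  (esym f k)%:Z = (\prod_i ((f i)%:Z *: 'X + 1))`_k.
Proof.
rewrite bigA_distr /esym coef_sum [RHS](bigID (fun Y : {set I} => #|Y| == k)) /=.
have term (Y : {set I}) : (\prod_i (if i \in Y then (f i)%:Z *: 'X else 1))
    = (\prod_(i in Y) f i)%N%:Z *: 'X^#|Y| :> {poly int}.
  rewrite -big_mkcond /= (big_morph _ PoszM (erefl _)).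
  by rewrite scaler_prod prodr_const.
rewrite [X in _ + X]big1 ?addr0 => [|Y Yk]; last first.
  by rewrite term coefZ coefXn eq_sym (negPf Yk) mulr0.
rewrite (big_morph _ PoszD (erefl _)); apply: eq_bigr => Y /eqP Yk.
by rewrite term coefZ coefXn Yk eqxx mulr1.
Qed.

(** The generating polynomial is [(a X + 1) ^ #|L| * (b X + 1) ^ (#|I| - #|L|)], which depends on
    cardinalities only. *)
Lemma esym_two_valued (I I' : finType) (L : {set I}) (L' : {set I'}) a b k :
    #|I| = #|I'| -> #|L| = #|L'| ->
  esym (fun i => if i \in L then a else b) k =
  esym (fun i => if i \in L' then a else b) k.
Proof.
move=> II LL.
have prodE (T : finType) (K : {set T}) :
    \prod_i ((if i \in K then a else b)%:Z *: 'X + 1)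
    = (a%:Z *: 'X + 1) ^+ #|K| * (b%:Z *: 'X + 1) ^+ (#|T| - #|K|) :> {poly int}.
  rewrite (bigID (mem K)) /=; congr (_ * _).
    by rewrite (eq_bigr (fun=> a%:Z *: 'X + 1)) ?prodr_const // => i ->.
  rewrite (eq_bigr (fun=> b%:Z *: 'X + 1)) => [|i /negPf->//].
  rewrite prodr_const; congr (_ ^+ _).
  by rewrite -[X in (X - _)%N](cardC (mem K)) addKn; apply: eq_card => i; rewrite !inE.
by apply/eqP; rewrite -eqz_nat !esym_coef !prodE II LL.
Qed.
End TwoValued.

(** * Base expansions and the lexicographic order *)

Lemma digits_value_lt (n B : nat) (a : nat -> nat) :
  0 < B -> (forall j, a j < B) -> \sum_(j < n) a j * B ^ (n - j) + B <= B ^ n.+1.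
Proof.
(* The lowest digit has weight [B], not 1, so the largest value is [B ^ n.+1 - B]. *)
move=> B0; elim: n a => [|n IH] a aB; first by rewrite big_ord0 expn1.
rewrite big_ord_recl subn0 -addnA.
have := IH (fun j => a j.+1) (fun j => aB j.+1) => {}IH.
apply: leq_trans (_ : (a 0).+1 * B ^ n.+1 <= _); last by rewrite [B ^ n.+2]expnS leq_mul.
by rewrite mulSn addnC leq_add2r.
Qed.

(** A larger leading digit cannot be compensated by the remaining ones. *)
Lemma lexi_digits (n B : nat) (a b : nat -> nat) :
    (forall j, a j < B) -> (forall j, b j < B) ->
    \sum_(j < n) a j * B ^ (n - j) <= \sum_(j < n) b j * B ^ (n - j) ->
  ([seq a j | j <- iota 0 n] <= [seq b j | j <- iota 0 n] :> seqlexi nat)%O.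
Proof.
elim: n a b => [|n IH] a b aB bB //.
have B0 : 0 < B by apply: leq_ltn_trans (aB 0).
have recl (f : nat -> nat) : \sum_(j < n.+1) f j * B ^ (n.+1 - j)
    = f 0 * B ^ n.+1 + \sum_(j < n) f j.+1 * B ^ (n - j) by rewrite big_ord_recl subn0.
rewrite !recl /= lexi_cons !(iotaDl 1 0) -!map_comp => le_ab.
have ha := digits_value_lt n B0 (fun j => aB j.+1).
have hb := digits_value_lt n B0 (fun j => bB j.+1).
have Bn : 0 < B ^ n.+1 by rewrite expn_gt0 B0.
rewrite leEnat; case: (ltngtP (a 0) (b 0)) => [//|lt|eq0] /=.
  have : (b 0).+1 * B ^ n.+1 <= a 0 * B ^ n.+1 by rewrite leq_mul2r lt orbT.
  rewrite mulSn; rewrite /= in ha hb; lia.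
by apply: IH => //; move: le_ab; rewrite eq0 leq_add2l.
Qed.

Lemma lexi_cat (s1 t1 s2 t2 : seqlexi nat) : size s1 = size t1 ->
  (s1 <= t1)%O -> (s1 = t1 -> s2 <= t2)%O -> (s1 ++ s2 <= t1 ++ t2 :> seqlexi nat)%O.
Proof.
elim: s1 t1 => [|x s1 IH] [|y t1] //=; first by move=> _ _; apply.
case=> sz; rewrite !lexi_cons => /andP[xy /implyP st] h; rewrite xy /=.
apply/implyP => yx; apply: IH (st yx) _ => // e1; apply: h.
by congr cons => //; apply/eqP; rewrite eq_le xy yx.
Qed.

Definition gamma_row M k : seq nat := [seq gamma M k j | j <- iota 0 k.+1].

Lemma gamma_seq_le r M M' :
    (forall k, 1 <= k <= 3 * (r - 1) ->
       (forall i, 1 <= i < k -> gamma_row M i = gamma_row M' i) ->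
       (gamma_row M k <= gamma_row M' k :> seqlexi nat)%O) ->
  (gamma_seq r M <= gamma_seq r M')%O.
Proof.
suff gen n k0 : (forall k, k0 <= k < k0 + n ->
      (forall i, k0 <= i < k -> gamma_row M i = gamma_row M' i) ->
      (gamma_row M k <= gamma_row M' k :> seqlexi nat)%O) ->
    ([seq gamma M k j | k <- iota k0 n, j <- iota 0 k.+1] <=
     [seq gamma M' k j | k <- iota k0 n, j <- iota 0 k.+1] :> seqlexi nat)%O.
  by move=> rows; apply: gen => k; rewrite add1n ltnS; apply: rows.
elim: n k0 => [|n IH] k0 rows //.
apply: (@lexi_cat (gamma_row M k0) (gamma_row M' k0)); first by rewrite !size_map.
  by apply: rows => [|i]; lia.
move=> row0; apply: IH => k k0k eq_rows; apply: rows => [|i i0k]; first lia.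
by case: (ltngtP k0 i) => [ki|ik|<-//]; [apply: eq_rows | ]; lia.
Qed.

(** * Sizes of expanded structures *)

Section ExpandCounts.
Variables (r c lambda : nat) (M : marked_structure).
Hypothesis cM : is_cubic_marked r lambda M.

Lemma sum_chain_len : \sum_(e : edge (base M)) chain_len c e = c * (3 * (r - 1)) + lambda.
Proof.
have [_ _ <-] := cM; rewrite -(cubic_card_edge cM).
rewrite (eq_bigr (fun e => c + (e \in long M))) => [|e _]; last first.
  by rewrite /chain_len; case: (e \in long M); lia.
by rewrite big_split /= sum_nat_const mulnC -big_mkcond /= sum1_card.
Qed.

Lemma card_edge_expand : #|edge (expand M c)| = c * (3 * (r - 1)) + lambda.
Proof. by rewrite -sum_chain_len; apply: card_edge_subdivide. Qed.

(** The equality case of [balanced_square_le], summed over the chains. *)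
Lemma sum_square_chain_len :
  \sum_(e : edge (base M)) chain_len c e ^ 2 + 3 * (r - 1) * (c * c.+1)
    = (2 * c + 1) * (c * (3 * (r - 1)) + lambda).
Proof.
rewrite -sum_chain_len -(cubic_card_edge cM) -sum_nat_const -big_split big_distrr /=.
by apply: eq_bigr => e _; rewrite /chain_len; case: ifP => _; lia.
Qed.

Hypothesis c_gt0 : 0 < c.

Let len_gt0 (e : edge (base M)) : 0 < chain_len c e.
Proof. by rewrite /chain_len; case: ifP. Qed.

Lemma card_vertex_expand :
  #|vertex (expand M c)| = 2 * (r - 1) + (c - 1) * (3 * (r - 1)) + lambda.
Proof.
have -> : #|vertex (expand M c)|
    = #|vertex (base M)| + \sum_(e : edge (base M)) (chain_len c e).-1.
  exact: card_vertex_subdivide.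
have [_ -> _] := cM; rewrite -addnA; congr (_ + _).
have : \sum_(e : edge (base M)) (chain_len c e).-1 + #|edge (base M)| = c * (3 * (r - 1)) + lambda.
  rewrite -sum_chain_len -sum1_card -big_split /=.
  by apply: eq_bigr => e _; have := len_gt0 e; lia.
rewrite (cubic_card_edge cM); case: c c_gt0 => // c' _; rewrite subn1 /= mulSn; lia.
Qed.

End ExpandCounts.

Lemma gamma_uncut M (k : nat) :
  (forall X : {set edge (base M)}, #|X| = k -> ~~ cut_set X) ->
  forall j, gamma M k j = 0.
Proof.
move=> nc j; rewrite gamma_sum big1 // => Y /andP[cY /eqP/nc].
by rewrite cY.
Qed.

(** * Comparison of a most reliable graph with expanded structures *)

Theorem theorem2p9 (R : realType) (r : nat) (hr : 2 <= r) :
  exists n0 : nat, forall n : nat, n0 < n ->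
    forall c lambda : nat, 1 <= c -> lambda < 3 * (r - 1) ->
      n = 2 * (r - 1) + (c - 1) * (3 * (r - 1)) + lambda ->
    forall G : mgraph, #|vertex G| = n -> redundancy G = (r%:Z)%R ->
      most_reliable_near_zero R G ->
    exists M : marked_structure,
      asymptotically_most_reliable r lambda M /\ isomorphic G (expand M c).
Proof.
pose s := 3 * (r - 1).
(* If [c <= 4 ^ s], then [(c - 1) * s <= 4 ^ s * s] and [lambda < s], so [n] could not exceed this
   bound. *)
exists (2 * (r - 1) + 4 ^ s * s + s) => n n_large c lambda c1 ls nE G VG redG best.
rewrite -/s in ls nE.
have c_large : 4 ^ s < c.
  rewrite ltnNge; apply/negP => cs.
  have : (c - 1) * s <= 4 ^ s * s by rewrite leq_mul2r; apply/orP; right; lia.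
  lia.
have EV : #|vertex G| + r = #|edge G| + 1 by move: redG; rewrite /redundancy; lia.
have EG : #|edge G| = c * s + lambda.
  have : c * s = (c - 1) * s + s by rewrite addnC -mulSn; congr (_ * _); lia.
  have : s = 3 * (r - 1) by [].
  by rewrite VG nE in EV; move: ((c - 1) * s) (c * s) EV; lia.
have compare M' : is_cubic_marked r lambda M' -> forall k,
    (forall i, i < k -> cuts G i = cuts (expand M' c) i) ->
    cuts G k <= cuts (expand M' c) k.
  move=> cM' k; apply: (most_reliable_cuts best).
    by rewrite (card_vertex_expand cM' c1) VG.
  by rewrite (card_edge_expand c cM') EG.
have esymE M M' k : is_cubic_marked r lambda M -> is_cubic_marked r lambda M' ->
    esym (@chain_len M c) k = esym (@chain_len M' c) k.
  move=> cM cM'; apply: esym_two_valued.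
    by rewrite (cubic_card_edge cM) (cubic_card_edge cM').
  by have [_ _ ->] := cM; have [_ _ ->] := cM'.
have [M0 cM0 nc0] : exists2 M0, is_cubic_marked r lambda M0 &
    forall X : {set edge (base M0)}, #|X| <= 2 -> ~~ cut_set X.
  have [|S [cS VS ncS]] := @exists_uncut_cubic (r - 1); first lia.
  have ES : #|edge S| = s.
    by have := @cubic_card_edge r 0 (MarkedStructure (set0 : {set edge S})); apply; split; rewrite ?cards0.
  (* Any [lambda] edges of the ladder may be marked. *)
  have : 0 < #|[set X : {set edge S} | #|X| == lambda]|.
    by rewrite card_sized_sets bin_gt0 ES ltnW.
  case/card_gt0P=> L; rewrite inE => /eqP Ll.
  by exists (MarkedStructure L).
have gamma0 k j : k <= 2 -> gamma M0 k j = 0.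
  by move=> k2; apply: gamma_uncut => X Xk; apply: nc0; rewrite Xk.
have intact0 k : k <= 2 -> intact (expand M0 c) k = esym (@chain_len M0 c) k.
  move=> k2; rewrite -intact_expand // big1 ?addn0 // => j _.
  by rewrite gamma0.
have E0 := card_edge_expand c cM0.
have full0 k : k <= 1 -> cuts (expand M0 c) k = 0.
  move=> k1; apply: eq_card0 => X; rewrite !inE; apply/negP => /andP[cX /eqP Xk].
  have len_gt0 (e : edge (base M0)) : 0 < (if e \in long M0 then c.+1 else c) by case: ifP.
  (* A set of at most one edge is thin, so a cut would project to a cut of the ladder with at most
     one edge. *)
  have thX : thin X.
    apply/thinP => d d' dX d'X _; have : #|X| <= 1 by rewrite Xk.
    by move/card_le1_eqP; apply.
  have := cut_set_proj len_gt0 thX cX; apply/negP/nc0.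
  by apply: leq_trans (leq_imset_card _ _) _; rewrite Xk leqW.
have cuts0 : cuts G 0 = 0.
  by have := compare _ cM0 0; rewrite full0 // leqn0 => h; apply/eqP/h.
have cuts1 : cuts G 1 = 0.
  have := compare _ cM0 1; rewrite full0 // leqn0 => h; apply/eqP/h => i.
  by rewrite ltnS leqn0 => /eqP->; rewrite cuts0 full0.
have cuts2 : cuts G 2 <= cuts (expand M0 c) 2.
  by apply: compare => // -[|[|//]] _; rewrite ?cuts0 ?cuts1 full0.
have i0 : intact G 0 = 1 by have := cuts_intact G 0; rewrite bin0 cuts0.
have i1 : intact G 1 = #|edge G| by have := cuts_intact G 1; rewrite bin1 cuts1.
have [M [cM iso]] : exists M, is_cubic_marked r lambda M /\ isomorphic G (expand M c).
  apply: balanced_cubic_structure => //.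
  (* Fewer cut pairs than the expanded ladder means at least as many non-cut pairs, and for the
     ladder these attain the second symmetric function of balanced lengths. *)
  have := cuts_intact G 2; have := cuts_intact (expand M0 c) 2; rewrite E0 -/s -EG => h1 h2.
  have := esym2_square_sum (@chain_len M0 c).
  rewrite (sum_chain_len c cM0) -/s -EG -intact0 //.
  have := sum_square_chain_len c cM0; rewrite -/s -EG; lia.
exists M; split => //; split => // M' cM'.
have sE := cubic_card_edge cM; have sE' := cubic_card_edge cM'.
have countM k : intact G k + \sum_(j < k.+1) gamma M k j * c ^ (k - j)
    = esym (@chain_len M c) k.
  by rewrite (isomorphic_intact _ iso) intact_expand.
have gammaM01 k j : k <= 1 -> j <= k -> gamma M k j = 0.
  move=> k1 jk; have := countM k; rewrite (esymE M M0) // -intact0 1?leqW //.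
  have := cuts_intact (expand M0 c) k; rewrite full0 // E0 -/s -EG.
  have := cuts_intact G k; have -> : cuts G k = 0 by case: k k1 jk => [|[]].
  rewrite !add0n => -> -> /eqP; rewrite -[X in _ == X]addn0 eqn_add2l.
  rewrite sum_nat_eq0 => /forallP/(_ (Ordinal (jk : j < k.+1))) /=.
  by rewrite muln_eq0 expn_eq0 [c == 0]gtn_eqF // orbF => /eqP.
apply: gamma_seq_le => k /andP[k1 ks] rows.
have gammaE i j : 1 <= i < k -> j <= i -> gamma M i j = gamma M' i j.
  move=> /rows eq_row ji; have := congr1 (nth 0 ^~ j) eq_row.
  by rewrite !(nth_map 0) ?size_iota // nth_iota.
(* Row 1 of [M] vanishes and is therefore minimal; from row 2 on, equality of row 1 is available. *)
case: (ltngtP k 1) k1 => // [k1|->] _; last first.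
  rewrite /gamma_row /= !lexi_cons /= !gammaM01 //.
  by rewrite !leEnat !leq0n /= !implybT.
(* Rows start at 1, so cuts of size 0 are handled apart: if the empty set were a cut, every single
   edge would be one too, and [gamma M' 1 0] would be positive. *)
have connected' : ~~ cut_set (set0 : {set edge (base M')}).
  apply/negP => c0.
  have : 0 < #|edge (base M')| by rewrite sE'; lia.
  case/card_gt0P=> e _.
  have : gamma M' 1 0 = 0 by rewrite -gammaE // gammaM01.
  move/eqP; rewrite gamma_sum sum_nat_eq0 => /forallP/(_ [set e]).
  rewrite cards1 eqxx bin0 andbT implybF => /negP[].
  have /cut_setP[A [Axy A0]] := c0.
  by apply/cut_setP; exists A; split=> // f _; apply: A0; rewrite inE.
(* Both structures have the same symmetric functions, so equal lower rows give equal lower cut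
   counts and the comparison reaches size [k]. *)
have cuts_eq i : i < k -> cuts G i = cuts (expand M' c) i.
  move=> ik; have := cuts_intact G i; have := cuts_intact (expand M' c) i.
  rewrite (card_edge_expand c cM') -/s -EG.
  have := countM i; rewrite (esymE M M') // -intact_expand //.
  rewrite (eq_bigr (fun j : 'I_i.+1 => gamma M' i j * c ^ (i - j))) => [|j _]; last first.
    case: i ik j => [|i] ik j; last by rewrite gammaE // -ltnS.
    by rewrite gammaM01 ?(gamma_uncut (k := 0)) // => [X /cards0_eq->|]; case: j => -[].
  by move=> /addIn-> <- /addIn.
have le_k : intact (expand M' c) k <= intact G k.
  have := compare M' cM' k cuts_eq.
  have := cuts_intact G k; have := cuts_intact (expand M' c) k.
  rewrite (card_edge_expand c cM') -/s -EG; lia.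
have le_gamma : \sum_(j < k.+1) gamma M k j * c ^ (k - j)
    <= \sum_(j < k.+1) gamma M' k j * c ^ (k - j).
  have := countM k; rewrite (esymE M M') // -intact_expand //; lia.
apply: (@lexi_digits _ c) => [j|j|].
- by apply: leq_ltn_trans c_large; rewrite /s -sE gamma_le.
- by apply: leq_ltn_trans c_large; rewrite /s -sE' gamma_le.
(* With [k.+1] digits, [lexi_digits] uses weights one power of [c] higher than the cut counts do. *)
have scale M1 : \sum_(j < k.+1) gamma M1 k j * c ^ (k.+1 - j)
    = c * \sum_(j < k.+1) gamma M1 k j * c ^ (k - j).
  rewrite big_distrr; apply: eq_bigr => j _.
  by rewrite subSn -1?ltnS // expnS mulnCA.
by rewrite !scale leq_mul2l le_gamma orbT.
Qed.
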